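(* Let $X=\langle a,b : a^6=b^2=e,\ ab=ba^5\rangle$ be the dihedral group with 12 elements, $G=\{e,a^2,a^4,b,ba^2,ba^4\}$ and $M=\{e,a\}$. Then the braided Hopf algebra $D$ in $\mathcal{D}$ associated with $(X,G,M)$ is not braided commutative: with $\mu:D\otimes D\to D$ the product and $\Psi$ the braiding, it is not true that $\mu(\xi\otimes\eta)=\mu(\Psi(\xi\otimes\eta))$ for all $\xi,\eta\in D$.
   Context: $X$ is a finite group with identity $e$, $G\subset X$ a subgroup, and $M\subset X$ a set of coset representatives with $e\in M$: every $x\in X$ factors uniquely as $x=us$ with $u\in G$, $s\in M$. For $s,t\in M$, $u\in G$ define $\tau(s,t),\,s\triangleright u\in G$ and $s\cdot t,\,s\triangleleft u\in M$ by $st=\tau(s,t)(s\cdot t)$ and $su=(s\triangleright u)(s\triangleleft u)$. Vector spaces are over a field $k$. For $y,x\in X$ put $y\tilde\triangleleft x=x^{-1}yx$. For $v,w\in G$, $t,p\in M$ put $(vt)\circ(wp)=wvtp$, $\tilde\tau(vt,wp)=\tau(t,p)$, and $vt\,\tilde\triangleright\, wp=v^{-1}wpv'=twpt'^{-1}$, where $vt\,\tilde\triangleleft\, wp=v't'$ with $v'\in G$, $t'\in M$. Objects of $\mathcal{D}$ are $X$-graded vector spaces with right $X$-action $\hat\triangleleft$ such that $\|\xi\hat\triangleleft x\|=\|\xi\|\tilde\triangleleft x$, where $\|\xi\|\in X$ is the grade of a homogeneous $\xi$; $|\xi|\in G$ and $\langle\xi\rangle\in M$ are defined by $\|\xi\|=|\xi|^{-1}\langle\xi\rangle$.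 The braiding is $\Psi(\xi\otimes\eta)=\eta\hat\triangleleft(\langle\xi\rangle\triangleleft|\eta|)^{-1}\otimes\xi\hat\triangleleft|\eta|$. $D$ is the vector space with basis $\delta_y\otimes x$ ($x,y\in X$), with grade given by $y\circ\|\delta_y\otimes x\|=y\tilde\triangleleft x$, $X$-action $(\delta_y\otimes x)\hat\triangleleft z=\delta_{y\tilde\triangleleft(c\tilde\triangleright z)}\otimes(c\tilde\triangleright z)^{-1}xz$ and product $(\delta_y\otimes x)(\delta_w\otimes z)=\delta_{w,y\tilde\triangleleft x}\,\delta_{y\tilde\triangleleft\tilde\tau(c,d)}\otimes\tilde\tau(c,d)^{-1}xz$, where $c=\|\delta_y\otimes x\|$ and $d=\|\delta_w\otimes z\|$. *)

(* Defs.v *)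
From HB Require Import structures.
From mathcomp Require Import all_boot all_order all_algebra all_fingroup all_solvable.

Set Implicit Arguments.
Unset Strict Implicit.
Unset Printing Implicit Defensive.

Import GRing.Theory.
Local Open Scope ring_scope.

Record coset_triple (X : finGroupType) := CosetTriple {
  ctG : {group X};
  ctM : {set X};
  ctM1 : 1%g \in ctM;
  ctP : forall x : X, exists! us : X * X,
    [/\ us.1 \in ctG, us.2 \in ctM & x = (us.1 * us.2)%g]
}.

Section CosetOperations.
Variables (X : finGroupType) (C : coset_triple X).
Local Open Scope group_scope.

Definition factor (x : X) : X * X :=
  odflt (1, 1)
    [pick us : X * X | [&& us.1 \in ctG C, us.2 \in ctM C & x == us.1 * us.2]].

Definition gpart (x : X) : X := (factor x).1.
Definition mpart (x : X) : X := (factor x).2.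

Definition tau (s t : X) : X := gpart (s * t).
Definition ltri (s u : X) : X := mpart (s * u).

(* In the remaining operations the arguments range over X and are split as    *)
(* y = v t, z = w p.  The action of X on itself by y |-> z^-1 y z is          *)
(* mathcomp's conjugation y ^ z.                                              *)
Definition tcirc (y z : X) : X := gpart z * gpart y * mpart y * mpart z.
Definition ttau (y z : X) : X := tau (mpart y) (mpart z).
Definition ttri (y z : X) : X := (gpart y)^-1 * z * gpart (y ^ z).

(* |xi| and <xi> for xi of grade x, read off from x = |xi|^-1 <xi>.           *)
Definition gabs (x : X) : X := (gpart x)^-1.
Definition gang (x : X) : X := mpart x.

Lemma factorP x : [/\ gpart x \in ctG C, mpart x \in ctM C
  & x = gpart x * mpart x].
Proof.
rewrite /gpart /mpart /factor; case: pickP => [us /and3P[? ? /eqP ?] //|no].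
case: (ctP C x) => us [[Gu Ms dx] _].
by have := no us; rewrite Gu Ms -dx eqxx.
Qed.

Lemma factor_uniq u s : u \in ctG C -> s \in ctM C ->
  gpart (u * s) = u /\ mpart (u * s) = s.
Proof.
move=> Gu Ms; have [Gg Mm dx] := factorP (u * s).
case: (ctP C (u * s)) => us [_ uniq_us].
have e1 := uniq_us (gpart (u * s), mpart (u * s)) (And3 Gg Mm dx).
have e2 := uniq_us (u, s) (And3 Gu Ms erefl).
by move: e1; rewrite e2 => -[<- <-].
Qed.

Lemma tcircE y z : tcirc y z = gpart z * y * mpart z.
Proof. by have [_ _ dy] := factorP y; rewrite /tcirc -(mulgA (gpart z)) -dy. Qed.

Lemma ttriE y z : ttri y z = mpart y * z * (mpart (y ^ z))^-1.
Proof.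
have [_ _ dy] := factorP y; have [_ _ dyz] := factorP (y ^ z).
apply: (mulIg (mpart (y ^ z))); rewrite /ttri -mulgA -dyz conjgE.
rewrite mulgKV !mulgA mulgK; congr (_ * _).
by apply: (canLR (mulKg _)).
Qed.

End CosetOperations.

Section Tensor.
Variable k : fieldType.

(* The tensor product of the finite-dimensional spaces V and W is realised on *)
(* matrices by the Kronecker product of coordinate vectors; tlift f is the    *)
(* linear map induced by a bilinear f.                                        *)
Definition tensor (V W : vectType k) : vectType k :=
  'M[k]_(\dim {:V}, \dim {:W}).

Definition tens (V W : vectType k) (v : V) (w : W) : tensor V W :=
  \matrix_(i, j) (coord (vbasis {:V}) i v * coord (vbasis {:W}) j w).

Definition tlift (V W U : vectType k) (f : V -> W -> U) (T : tensor V W) : U :=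
  \sum_i \sum_j T i j *: f (vbasis {:V})`_i (vbasis {:W})`_j.

Definition bilinear2 (V W U : vectType k) (f : V -> W -> U) : Prop :=
  (forall w, linear (fun v => f v w)) /\ (forall v, linear (f v)).

Lemma tlift_linear (V W U : vectType k) (f : V -> W -> U) : linear (tlift f).
Proof.
move=> c A B; rewrite /tlift scaler_sumr -big_split /=; apply: eq_bigr => i _.
rewrite scaler_sumr -big_split /=; apply: eq_bigr => j _.
by rewrite !mxE scalerDl scalerA.
Qed.

Lemma lin_sum (V U : vectType k) (f : V -> U) : linear f ->
  forall (I : finType) (P : pred I) (c : I -> k) (v : I -> V),
  f (\sum_(i | P i) c i *: v i) = \sum_(i | P i) c i *: f (v i).
Proof.
move=> lf I P c v; pose lin := GRing.isLinear.Build k V U _ f lf.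
pose F : {linear V -> U} := HB.pack f lin.
rewrite -[f]/(F : V -> U) linear_sum; apply: eq_bigr => i _.
by rewrite linearZ.
Qed.

Lemma tlift_tens (V W U : vectType k) (f : V -> W -> U) v w :
  bilinear2 f -> tlift f (tens v w) = f v w.
Proof.
case=> lf1 lf2; rewrite [in RHS](coord_vbasis (memvf v)).
rewrite (lin_sum (lf1 w)); apply: eq_bigr => i _.
rewrite [in RHS](coord_vbasis (memvf w)) (lin_sum (lf2 _)) scaler_sumr.
by apply: eq_bigr => j _; rewrite scalerA mxE.
Qed.

Lemma tens_bilinear (V W : vectType k) : bilinear2 (@tens V W).
Proof.
split=> [w c x y|v c x y]; apply/matrixP=> i j; rewrite !mxE linearP /=.
  by rewrite mulrDl mulrA.
by rewrite mulrDr mulrCA.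
Qed.

End Tensor.

(* Finite-dimensional objects: X-graded spaces with a compatible right action *)
(* (act x v is v acted on by x).                                              *)
Record Dobj (k : fieldType) (X : finGroupType) := DObj {
  car :> vectType k;
  gr : X -> {vspace car};
  act : X -> 'End(car);
  gr_direct : directv (\sum_(x : X) gr x);
  gr_full : (\sum_(x : X) gr x)%VS = fullv;
  act1 : forall v, act 1%g v = v;
  actM : forall x y v, act (x * y)%g v = act y (act x v);
  act_gr : forall x y v, v \in gr y -> act x v \in gr (y ^ x)%g
}.

Section Braiding.
Variables (k : fieldType) (X : finGroupType) (C : coset_triple X).

(* The homogeneous component of grade x.                                      *)
Definition hcomp (V : Dobj k X) (x : X) : 'End(V) :=
  sumv_pi (\sum_(z : X) gr V z)%VS x.

Definition braid2 (V W : Dobj k X) (xi : V) (eta : W) : tensor W V :=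
  \sum_(x : X) \sum_(y : X)
    tens (act W (ltri C (gang C x) (gabs C y))^-1%g (hcomp W y eta))
         (act V (gabs C y) (hcomp V x xi)).

Definition braiding (V W : Dobj k X) : tensor V W -> tensor W V :=
  tlift (@braid2 V W).

Lemma hcomp_homog (V : Dobj k X) x y v : v \in gr V x ->
  hcomp V y v = if y == x then v else 0.
Proof.
move=> Vv; pose u z := if z == x then v else 0.
have Eu : v = \sum_(z : X) u z.
  by rewrite (bigD1 x) //= /u eqxx big1 ?addr0 // => z /negPf->.
have Es : v = \sum_(z : X) hcomp V z v.
  by rewrite sumv_pi_sum // gr_full memvf.
have uP z : true -> u z \in gr V z.
  by rewrite /u => _; case: eqP => [->|_]; rewrite ?mem0v.
have hP z : true -> hcomp V z v \in gr V z by move=> _; apply: memv_sum_pi.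
have /directv_sum_unique /(_ _ _ hP uP) := gr_direct V; rewrite -Eu -Es eqxx.
by move/esym/forallP/(_ y)/eqP.
Qed.

Lemma braid2_bilinear (V W : Dobj k X) : bilinear2 (@braid2 V W).
Proof.
split=> [w c u v|w c u v]; rewrite /braid2 scaler_sumr -big_split;
  apply: eq_bigr => x _; rewrite scaler_sumr -big_split; apply: eq_bigr => y _;
  rewrite !linearP.
  exact: (tens_bilinear W V).2.
exact: (tens_bilinear W V).1.
Qed.

Lemma braidingE (V W : Dobj k X) x y (xi : V) (eta : W) :
  xi \in gr V x -> eta \in gr W y ->
  braiding (tens xi eta) =
    tens (act W (ltri C (gang C x) (gabs C y))^-1%g eta) (act V (gabs C y) xi).
Proof.
move=> Vxi Weta; rewrite /braiding (tlift_tens _ _ (braid2_bilinear V W)).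
rewrite /braid2 (bigD1 x) //= (bigD1 y) //=.
rewrite (hcomp_homog x Vxi) (hcomp_homog y Weta) !eqxx.
have tn0 v : tens (0 : W) v = 0 :> tensor W V.
  by apply/matrixP=> i j; rewrite !mxE linear0 mul0r.
have t0n v : tens v (0 : V) = 0 :> tensor W V.
  by apply/matrixP=> i j; rewrite !mxE linear0 mulr0.
rewrite big1 => [|z /negPf nz]; last first.
  by rewrite (hcomp_homog z Weta) nz linear0 tn0.
rewrite addr0 big1 ?addr0 // => z /negPf nz; rewrite big1 // => t _.
by rewrite (hcomp_homog z Vxi) nz linear0 t0n.
Qed.

End Braiding.

Arguments braiding {k X} C V W _.

Section AlgebraD.
Variables (k : fieldType) (X : finGroupType) (C : coset_triple X).

(* The equation y o ||delta_y (x) x|| = x^-1 y x must determine the grade.    *)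
Definition grade_defined : Prop :=
  forall y x : X, exists! c : X, tcirc C y c = (y ^ x)%g.

(* The pair (y, x) stands for the basis vector delta_y (x) x.                 *)
Definition dgrade (p : X * X) : X :=
  odflt 1%g [pick c | tcirc C p.1 c == (p.1 ^ p.2)%g].

Definition dact (z : X) (p : X * X) : X * X :=
  let q := ttri C (dgrade p) z in (p.1 ^ q, q^-1 * p.2 * z)%g.

Definition Dspace : vectType k := {ffun X * X -> k^o}.

Definition dbasis (p : X * X) : Dspace := [ffun q => (q == p)%:R].

Definition Dgr (z : X) : {vspace Dspace} :=
  <<[seq dbasis p | p : X * X in [pred p | dgrade p == z]]>>%VS.

Definition Dact_fun (z : X) (f : Dspace) : Dspace :=
  \sum_(p : X * X) f p *: dbasis (dact z p).

Definition Dact (z : X) : 'End(Dspace) := linfun (Dact_fun z).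

Definition dmul (p r : X * X) : Dspace :=
  let t := ttau C (dgrade p) (dgrade r) in
  if r.1 == (p.1 ^ p.2)%g then dbasis (p.1 ^ t, t^-1 * p.2 * r.2)%g else 0.

Definition Dmul (f g : Dspace) : Dspace :=
  \sum_(p : X * X) \sum_(r : X * X) (f p * g r) *: dmul p r.

Lemma Dspace_sum (f : Dspace) : f = \sum_p f p *: dbasis p.
Proof.
apply/ffunP=> q; rewrite sum_ffunE (bigD1 q) //= !ffunE eqxx.
rewrite big1 => [|p /negPf np]; last by rewrite !ffunE eq_sym np scaler0.
by rewrite addr0 /GRing.scale /= mulr1.
Qed.

Lemma Dact_fun_linear z : linear (Dact_fun z).
Proof.
move=> c f g; rewrite /Dact_fun scaler_sumr -big_split; apply: eq_bigr => p _.
by rewrite !ffunE /= scalerDl scalerA.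
Qed.

HB.instance Definition _ z :=
  GRing.isLinear.Build k Dspace Dspace _ (Dact_fun z) (Dact_fun_linear z).

Lemma DactE z f : Dact z f = \sum_p f p *: dbasis (dact z p).
Proof. by rewrite lfunE. Qed.

Lemma Dact_basis z p : Dact z (dbasis p) = dbasis (dact z p).
Proof.
rewrite DactE (bigD1 p) //= ffunE eqxx scale1r big1 ?addr0 // => q /negPf nq.
by rewrite ffunE nq scale0r.
Qed.

Lemma Dmul_basis p r : Dmul (dbasis p) (dbasis r) = dmul p r.
Proof.
rewrite /Dmul (bigD1 p) //= (bigD1 r) //= !ffunE !eqxx mulr1 scale1r.
rewrite big1 => [|q /negPf nq]; last by rewrite ffunE nq mulr0 scale0r.
rewrite addr0 big1 ?addr0 // => q /negPf nq; rewrite big1 // => s _.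
by rewrite ffunE nq mul0r scale0r.
Qed.

Lemma Dmul_bilinear : bilinear2 Dmul.
Proof.
split=> [w c u v|w c u v]; rewrite /Dmul scaler_sumr -big_split;
  apply: eq_bigr => x _; rewrite scaler_sumr -big_split; apply: eq_bigr => y _;
  rewrite !ffunE /= scalerA -scalerDl.
  by rewrite mulrDl mulrA.
by rewrite mulrDr mulrCA.
Qed.

Lemma DgrE z : Dgr z = (\sum_(p : X * X | dgrade p == z) <[dbasis p]>)%VS.
Proof. by rewrite /Dgr span_def big_map big_enum. Qed.

Lemma dbasis_gr p : dbasis p \in Dgr (dgrade p).
Proof.
have sub : (<[dbasis p]> <= Dgr (dgrade p))%VS by rewrite DgrE; apply: (sumv_sup p) (subvv _).
exact: subvP sub _ (memv_line _).
Qed.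

Lemma Dgr0 z f p : f \in Dgr z -> dgrade p != z -> f p = 0.
Proof.
rewrite DgrE => /memv_sumP[u uP ->] np; rewrite sum_ffunE big1 // => q dq.
have /vlineP[c ->] := uP q dq.
rewrite !ffunE; case: eqP => [e|_]; last by rewrite scaler0.
by rewrite e dq in np.
Qed.

Lemma Dgr_sum z f : f \in Dgr z ->
  f = \sum_(p | dgrade p == z) f p *: dbasis p.
Proof.
move=> fz; rewrite [LHS]Dspace_sum (bigID (fun p => dgrade p == z)) /=.
by rewrite [X in _ + X]big1 ?addr0 // => p np; rewrite (Dgr0 fz np) scale0r.
Qed.

Lemma Dgr_direct : directv (\sum_(x : X) Dgr x).
Proof.
apply/(directv_sum_independent (Us := Dgr)) => u uP u0 z _; apply/ffunP=> p.
rewrite ffunE; case: (eqVneq (dgrade p) z) => [dz|nz]; last first.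
  exact: Dgr0 (uP z isT) nz.
have := congr1 (fun f : Dspace => f p) u0; rewrite sum_ffunE ffunE (bigD1 z) //=.
rewrite big1 ?addr0 // => y ny; apply: Dgr0 (uP y isT) _.
by rewrite dz eq_sym.
Qed.

Lemma Dgr_full : (\sum_(x : X) Dgr x)%VS = fullv.
Proof.
apply/eqP; rewrite eqEsubv subvf; apply/subvP=> f _.
rewrite [f]Dspace_sum memv_suml // => p _; apply: memvZ.
have sub : (Dgr (dgrade p) <= \sum_(z : X) Dgr z)%VS.
  exact: (sumv_sup (dgrade p)) (subvv _).
exact: subvP sub _ (dbasis_gr p).
Qed.

Lemma ttri1 y : ttri C y 1%g = 1%g.
Proof. by rewrite /ttri conjg1 mulg1 mulVg. Qed.

Lemma ttriM y z t : (ttri C y (z * t) = ttri C y z * ttri C (y ^ z) t)%g.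
Proof. by rewrite /ttri conjgM !mulgA mulgK. Qed.

Hypothesis gdef : grade_defined.

Lemma dgradeP y x : tcirc C y (dgrade (y, x)) = (y ^ x)%g.
Proof.
rewrite /dgrade /=; case: pickP => [c /eqP //|no].
by have [c [cP _]] := gdef y x; have := no c; rewrite cP eqxx.
Qed.

Lemma dgrade_uniq y x c : tcirc C y c = (y ^ x)%g -> dgrade (y, x) = c.
Proof.
move=> cP; have [d [_ ud]] := gdef y x.
by rewrite -(ud c cP) -(ud _ (dgradeP y x)).
Qed.

Lemma dgrade_act z p : dgrade (dact z p) = (dgrade p ^ z)%g.
Proof.
case: p => y x; rewrite /dact /=; set c := dgrade (y, x); set q := ttri _ c z.
apply: dgrade_uniq; rewrite -!mulgA -(conjgM y) mulKVg (conjgM y x) -(dgradeP y x) -/c.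
rewrite !tcircE /q /ttri; have [_ _ dc] := factorP C c.
have [_ _ dcz] := factorP C (c ^ z)%g.
rewrite -[mpart C (c ^ z)](mulKg (gpart C (c ^ z))) -dcz.
rewrite -[in RHS](mulKg (gpart C c) (mpart C c)) -dc.
move: (gpart C c) (gpart C _) => w v.
by rewrite !conjgE !invMg invgK !mulgA !(mulgK, mulgKV, mulgV, mul1g).
Qed.

Lemma dact1 p : dact 1%g p = p.
Proof. by case: p => y x; rewrite /dact ttri1 /= conjg1 invg1 mul1g mulg1. Qed.

Lemma dactM z t p : dact (z * t)%g p = dact t (dact z p).
Proof.
rewrite {2}/dact dgrade_act /dact /= ttriM conjgM invMg.
by rewrite !mulgA.
Qed.

Lemma Dact1 v : Dact 1%g v = v.
Proof.
by rewrite DactE [RHS]Dspace_sum; apply: eq_bigr => p _; rewrite dact1.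
Qed.

Lemma DactM x y v : Dact (x * y)%g v = Dact y (Dact x v).
Proof.
rewrite [Dact (x * y)%g v]DactE (DactE x) linear_sum; apply: eq_bigr => p _.
by rewrite linearZ /= Dact_basis dactM.
Qed.

Lemma Dact_gr x y v : v \in Dgr y -> Dact x v \in Dgr (y ^ x)%g.
Proof.
move=> vy; rewrite (Dgr_sum vy) linear_sum memv_suml // => p /eqP <-.
by rewrite linearZ memvZ //= Dact_basis -dgrade_act dbasis_gr.
Qed.

Definition Dalg : Dobj k X :=
  DObj Dgr_direct Dgr_full Dact1 DactM Dact_gr.

End AlgebraD.

Lemma normal_grade_defined (X : finGroupType) (C : coset_triple X) :
  (ctG C <| [set: X])%g -> grade_defined C.
Proof.
move=> /andP[_ nG] y x; have [Gu Ms dw] := factorP C (y^-1 * y ^ x)%g.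
have GJ g h : (g ^ h \in ctG C)%g = (g \in ctG C).
  by rewrite memJ_norm // (subsetP nG) ?inE.
set u := gpart C _ in Gu dw; set s := mpart C _ in Ms dw.
have Gv : (u ^ y^-1)%g \in ctG C by rewrite GJ.
exists ((u ^ y^-1) * s)%g; split=> [|c].
  have [e1 e2] := factor_uniq Gv Ms; rewrite tcircE e1 e2.
  by rewrite (conjgE u) invgK mulgA mulgKV -mulgA -dw mulKVg.
rewrite tcircE => cP; have [Gc Mc dc] := factorP C c.
have Gc' : (gpart C c ^ y)%g \in ctG C by rewrite GJ.
have [e1 e2] := factor_uniq Gc' Mc.
have e : (gpart C c ^ y * mpart C c = y^-1 * y ^ x)%g.
  by rewrite -cP conjgE !mulgA.
by rewrite /u /s -e e1 e2 conjgK -dc.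
Qed.

Section Dihedral.
Variables (X : finGroupType) (a b : X).
Local Open Scope group_scope.

(* a and b generate X and satisfy the relations, and these present X; the     *)
(* last clause quantifies over finite groups only, which is harmless since    *)
(* the relations define a finite group.                                       *)
Definition dihedral12 : Prop :=
  [/\ <<[set a; b]>> = [set: X],
      [/\ a ^+ 6 = 1, b ^+ 2 = 1 & a * b = b * a ^+ 5]
    & [set: X] \isog Grp (x : y : x ^+ 6, y ^+ 2, x * y = y * x ^+ 5)].

Definition dihG : {set X} :=
  [set 1; a ^+ 2; a ^+ 4; b; b * a ^+ 2; b * a ^+ 4].
Definition dihM : {set X} := [set 1; a].

Hypothesis hX : dihedral12.

Let a6 : a ^+ 6 = 1. Proof. by case: hX => _ []. Qed.
Let b2 : b ^+ 2 = 1. Proof. by case: hX => _ []. Qed.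
Let ab : a * b = b * a ^+ 5. Proof. by case: hX => _ []. Qed.

Lemma dihedral12_form x : exists j i, x = b ^+ j * a ^+ i.
Proof.
have: x \in [set: X] by rewrite inE.
case: hX => <- _ _.
have nab : <[b]> \subset 'N(<[a]>).
  rewrite cycle_subG; apply/normP/eqP; rewrite eqEcard cardJg leqnn andbT.
  by rewrite -cycleJ cycle_subG conjgE ab mulKg mem_cycle.
have -> : <<[set a; b]>> = <[b]> * <[a]>.
  by rewrite -norm_joinEl // joingC /cycle joing_idl joing_idr.
by case/mulsgP=> _ _ /cycleP[j ->] /cycleP[i ->] ->; exists j, i.
Qed.

Lemma dihedral12_card : (12 <= #|X|)%N.
Proof.
have [_ _ isoX] := hX.
have homD : [set: 'D_12] \homg [set: X].
  rewrite isoX; apply/existsP.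
  have := isoGrp_hom (@Grp_dihedral 6 isT) => /existsP[[x y]] /=.
  case/eqP=> gen x6 y2 xy; exists (x, y); rewrite /= !xpair_eqE gen x6 y2 !eqxx /=.
  apply/eqP; rewrite conjgC xy; congr (y * _).
  by apply: (mulgI x); rewrite mulgV -expgS x6.
have := card_homg homD; rewrite [#|[set: X]|]cardsT (@card_dihedral 6) //.
by apply: dvdn_leq; apply/card_gt0P; exists 1.
Qed.

Let form (p : 'I_2 * 'I_6) : X := b ^+ p.1 * a ^+ p.2.

Let bmod j : b ^+ j = b ^+ (j %% 2). Proof. by rewrite expg_mod. Qed.
Let amod i : a ^+ i = a ^+ (i %% 6). Proof. by rewrite expg_mod. Qed.

Lemma dihedral12_inj : injective form.
Proof.
have surj x : x \in codom form.
  have [j [i ->]] := dihedral12_form x; apply/codomP.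
  exists (Ordinal (ltn_pmod j (isT : (0 < 2)%N)), Ordinal (ltn_pmod i (isT : (0 < 6)%N))).
  by rewrite /form /= -bmod -amod.
apply/injectiveP/card_uniqP; rewrite size_codom card_prod !card_ord.
apply/eqP; rewrite eqn_leq; apply/andP; split.
  by rewrite (leq_trans (card_size _)) // size_codom card_prod !card_ord.
rewrite (leq_trans dihedral12_card) //; apply/subset_leq_card/subsetP=> x _.
exact: surj.
Qed.

Let par (e : bool) x := exists j i, odd i = e /\ x = b ^+ j * a ^+ i.

Let par_ex x : exists e, par e x.
Proof. by have [j [i ->]] := dihedral12_form x; exists (odd i), j, i. Qed.

Let parM e f x y : par e x -> par f y -> par (e (+) f) (x * y).
Proof.
have aib i : a ^+ i * b = b * a ^+ (5 * i).
  elim: i => [|i IH]; first by rewrite muln0 mul1g mulg1.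
  by rewrite expgSr -mulgA ab mulgA IH -mulgA -expgD mulnS addnC.
have aibj j i : exists2 i', a ^+ i * b ^+ j = b ^+ j * a ^+ i' & odd i' = odd i.
  elim: j i => [|j IH] i; first by exists i; rewrite // mulg1 mul1g.
  have [i' e1 e2] := IH (5 * i)%N; exists i'; last by rewrite e2 oddM.
  by rewrite expgS mulgA aib -mulgA e1 mulgA.
case=> j [i [<- ->]] [j' [i' [<- ->]]].
have [i'' e1 e2] := aibj j' i; exists (j + j')%N, (i'' + i')%N.
by rewrite oddD e2 expgD (expgD a) !mulgA -(mulgA _ _ (b ^+ j')) e1 !mulgA.
Qed.

Let parG x : par false x <-> x \in dihG.
Proof.
split=> [[j [i [oi ->]]]|]; last first.
  rewrite !inE -!orbA => /or4P[|||/or3P[]] /eqP->;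
  [exists 0%N, 0%N | exists 0%N, 2%N | exists 0%N, 4%N | exists 1%N, 0%N | exists 1%N, 2%N
  | exists 1%N, 4%N]; by rewrite ?mul1g ?mulg1.
rewrite bmod amod; have: odd (i %% 6) = false by rewrite odd_mod.
have := ltn_pmod j (isT : (0 < 2)%N); have := ltn_pmod i (isT : (0 < 6)%N).
move: (i %% 6)%N (j %% 2)%N.
by move=> [|[|[|[|[|[|//]]]]]] [|[|//]] //= _ _ _; rewrite !inE ?mul1g ?mulg1 !eqxx
  ?orbT.
Qed.

Let par_excl x : par true x -> par false x -> False.
Proof.
case=> j [i [oi ->]] [j' [i' [oi' e]]].
have := @dihedral12_inj
  (Ordinal (ltn_pmod j (isT : (0 < 2)%N)), Ordinal (ltn_pmod i (isT : (0 < 6)%N)))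
  (Ordinal (ltn_pmod j' (isT : (0 < 2)%N)), Ordinal (ltn_pmod i' (isT : (0 < 6)%N))).
rewrite /form /= -!bmod -!amod => /(_ e) [_ /(congr1 odd)].
by rewrite !odd_mod // oi oi'.
Qed.

Let par_a : par true a. Proof. by exists 0%N, 1%N; rewrite mul1g. Qed.
Let par_1 : par false 1. Proof. by exists 0%N, 0%N; rewrite mul1g. Qed.

Let parV e x : par e x -> par e x^-1.
Proof.
move=> ex; have [f fx] := par_ex x^-1; have := parM ex fx; rewrite mulgV.
by case: e f ex fx => [] [] //= _ _ /par_excl /(_ par_1).
Qed.

Lemma dihG_group_set : group_set dihG.
Proof.
apply/group_setP; split; first by apply/parG.
by move=> x y /parG px /parG py; apply/parG; apply: parM px py.
Qed.

Definition dihG_group : {group X} := Group dihG_group_set.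

Lemma dihG_normal : dihG_group <| [set: X].
Proof.
rewrite /normal subsetT; apply/subsetP=> x _; rewrite inE; apply/subsetP=> y.
case/imsetP=> g /parG pg ->; apply/parG; rewrite conjgE.
have [e ex] := par_ex x; have := parM (parV ex) (parM pg ex).
by case: (e).
Qed.

Lemma dihM1 : 1 \in dihM. Proof. by rewrite !inE eqxx. Qed.

Lemma dih_factor (x : X) : exists! us : X * X,
  [/\ us.1 \in dihG_group, us.2 \in dihM & x = us.1 * us.2].
Proof.
have aG : a \notin dihG by apply/negP => /parG; apply: par_excl par_a.
have [[] px] := par_ex x.
  exists (x * a^-1, a); split=> [|[u s] /= [Gu /set2P[]-> dx]].
  - split=> /=; last by rewrite mulgKV.
      apply/(parG (x * a^-1)); exact: (parM px (parV par_a)).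
    by rewrite !inE eqxx orbT.
  - by case: (par_excl px); apply/parG; rewrite dx mulg1.
  by rewrite dx mulgK.
exists (x, 1); split=> [|[u s] /= [Gu /set2P[]-> dx]].
- by split=> /=; [apply/(parG x) | rewrite !inE eqxx | rewrite mulg1].
- by rewrite dx mulg1.
have pu : par false u by apply/parG.
by case: (par_excl (parM pu par_a)); rewrite -dx.
Qed.

Definition dihedral_triple : coset_triple X := CosetTriple dihM1 dih_factor.

Lemma dihedral_grade_defined : grade_defined dihedral_triple.
Proof. exact/normal_grade_defined/dihG_normal. Qed.

End Dihedral.

Lemma dihedral12_ex : exists (X : finGroupType) (a b : X), dihedral12 a b.
Proof.
have /existsP[[x y]] /= := isoGrp_hom (@Grp_dihedral 6 isT).
case/eqP=> gen x6 y2 xy.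
have rel (gT : finGroupType) (u v : gT) : (u ^+ 6 = 1)%g ->
    (u ^ v = u^-1)%g <-> (u * v = v * u ^+ 5)%g.
  move=> u6; have u5 : (u ^+ 5 = u^-1)%g.
    by apply: (mulgI u); rewrite mulgV -expgS u6.
  by rewrite u5 conjgC; split=> [-> //|/mulgI].
exists _, x, y; split.
- by rewrite -gen /cycle joing_idl joing_idr.
- by split=> //; apply/rel.
move=> rT H; rewrite (@Grp_dihedral 6 isT); apply/existsP/existsP.
  case=> [[u v]] /eqP[genH u6 v2 /rel e]; exists (u, v) => /=.
  by rewrite genH u6 v2 e.
case=> [[u v]] /eqP[genH u6 v2 /rel e]; exists (u, v) => /=.
by rewrite genH u6 v2 e.
Qed.

(* Main.v *)
Require Import Defs.
From mathcomp Require Import all_boot all_order all_algebra all_fingroup all_solvable.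

Set Implicit Arguments.
Unset Strict Implicit.
Unset Printing Implicit Defensive.

(** The elements delta_w (x) 1 have trivial grade, so the braiding moves
    delta_y (x) x past them without changing either factor as soon as the grade
    of delta_y (x) x lies in G.  Braided commutativity would therefore make them
    commute with delta_y (x) x in the ordinary sense.  But, as idempotents,
    they detect the two ends of delta_y (x) x: the product
    (delta_y (x) x)(delta_w (x) 1) survives only for w = y^x, and
    (delta_w (x) 1)(delta_y (x) x) only for w = y.  Hence any y, x with
    y^x <> y and y^x y^-1 in G, which is then the grade of delta_y (x) x, refute
    braided commutativity: this is [not_braided_commutative].  In the dihedral
    group y = b and x = a will do, since b^a b^-1 = a^4 is in G and is not 1. *)

Import GRing.Theory.
Local Open Scope ring_scope.

Section TrivialMPart.
Variables (X : finGroupType) (C : coset_triple X).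
Local Open Scope group_scope.

Lemma factor_in_G u : u \in ctG C -> gpart C u = u /\ mpart C u = 1.
Proof. by move=> Gu; have := factor_uniq Gu (ctM1 C); rewrite mulg1. Qed.

(** The defining equation y o c = y^x of the grade reads c y = y^x when c has
    trivial M-part. *)
Lemma dgrade_in_G (gdef : grade_defined C) y x :
  y ^ x * y^-1 \in ctG C -> dgrade C (y, x) = y ^ x * y^-1.
Proof.
move=> Gc; apply: (dgrade_uniq gdef).
by have [gc mc] := factor_in_G Gc; rewrite tcircE gc mc mulg1 mulgKV.
Qed.

Lemma dmul_in_G (k : fieldType) p r :
  dgrade C p \in ctG C -> dgrade C r \in ctG C ->
  dmul k C p r =
    (if r.1 == p.1 ^ p.2 then dbasis k (p.1, p.2 * r.2) else 0%R).
Proof.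
move=> /factor_in_G[_ mp] /factor_in_G[_ mr].
rewrite /dmul /ttau /tau mp mr mulg1 (factor_in_G (group1 _)).1.
by rewrite conjg1 invg1 mul1g.
Qed.

End TrivialMPart.

(** The witness is the pair delta_y (x) x and delta_(y^x) (x) 1, whose product
    is delta_y (x) x, while the product in the opposite order is 0. *)
Lemma not_braided_commutative (k : fieldType) (X : finGroupType)
    (C : coset_triple X) (gdef : grade_defined C) (y x : X) :
  (y ^ x * y^-1)%g \in ctG C -> (y ^ x)%g <> y ->
  let D := Dalg k gdef in
  let mu : tensor D D -> D := tlift (@Dmul k X C) in
  ~ (forall xi eta : D,
       mu (tens xi eta) = mu (braiding C D D (tens xi eta))).
Proof.
move=> Gc ny D mu comm_mu.
pose p := (y, x); pose r := ((y ^ x)%g, 1%g : X).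
have [g1 m1] := factor_in_G (group1 (ctG C)).
have dp : dgrade C p = (y ^ x * y^-1)%g by exact: dgrade_in_G.
have dr : dgrade C r = 1%g.
  by rewrite dgrade_in_G // conjg1 mulgV ?group1.
have Gp : dgrade C p \in ctG C by rewrite dp.
have Gr : dgrade C r \in ctG C by rewrite dr group1.
have := comm_mu (dbasis k p : D) (dbasis k r : D).
rewrite (braidingE C (V := D) (W := D) (dbasis_gr k C p) (dbasis_gr k C r)).
have /factor_in_G[_ mp] := Gp.
rewrite /gabs /gang /ltri dr g1 mp invg1 mulg1 m1 invg1 !Defs.act1.
rewrite /mu !(tlift_tens _ _ (Dmul_bilinear k C)) !Dmul_basis !dmul_in_G //=.
rewrite eqxx conjg1 (introF eqP (fun e => ny (esym e))).
move/ffunP/(_ (y, (x * 1)%g)); rewrite !ffunE eqxx => /eqP.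
by rewrite oner_eq0.
Qed.

Theorem mainTheorem4 (k : fieldType) (X : finGroupType) (a b : X)
    (hX : dihedral12 a b) :
  let C := dihedral_triple hX in
  let D := Dalg k (dihedral_grade_defined hX) in
  let mu : tensor D D -> D := tlift (@Dmul k X C) in
  ~ (forall xi eta : D,
       mu (tens xi eta) = mu (braiding C D D (tens xi eta))).
Proof.
have [_ [a6 b2 ab] _] := hX.
have aJb : (a ^ b = a ^+ 5)%g by rewrite conjgE ab mulKg.
(* Conjugation by b sends a^5 to a^25 = a. *)
have ba : (b * a = a ^+ 5 * b)%g.
  rewrite [RHS]conjgC conjXg aJb -expgM.
  by rewrite (expgD a 24 1) (expgM a 6 4) a6 expg1n mul1g.
have a4 : (b ^ a * b^-1 = a ^+ 4)%g.
  by rewrite conjgE ba mulgA mulgK expgS mulKg.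
apply: (@not_braided_commutative k X _ _ b a); first by rewrite a4 !inE eqxx !orbT.
move=> bJa; move: a4; rewrite bJa mulgV => a4.
have := @dihedral12_inj X a b hX (@Ordinal 2 0 isT, @Ordinal 6 0 isT)
  (@Ordinal 2 0 isT, @Ordinal 6 4 isT).
by rewrite /= !mul1g expg0 -a4 => /(_ erefl).
Qed.
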